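(* Let $P$ be a set of forbidden patterns (permutations, possibly of different lengths). Then $P$ is right-justified if and only if for every $\tau\in P$ such that $\tau^{\leftarrow}$ exists, the permutation $\tau^{\leftarrow}$ contains some pattern belonging to $P$.
   Context: $S_n$ is the set of permutations of $\{1,\dots,n\}$ written in one-line notation $\pi=\pi(1)\cdots\pi(n)$; $S_0=\{\epsilon\}$. A permutation $\pi$ contains a pattern $\sigma$ if some (not necessarily contiguous) subsequence of $\pi$ is order-isomorphic to $\sigma$; otherwise $\pi$ avoids $\sigma$. For a set $P$ of patterns, $S_n(P)$ is the set of permutations in $S_n$ avoiding every pattern of $P$, and $S(P)=\bigcup_{n\ge0}S_n(P)$. For $\alpha\in S_n$, $\alpha^{\rightarrow}$ (resp. $\alpha^{\leftarrow}$) is the permutation obtained by moving the largest entry $n$ one position to the right (resp. left); it is defined only when $n$ is not in the last (resp. first) position. $P$ is called right-justified if for every $\alpha\in S(P)$ for which $\alpha^{\rightarrow}$ is defined, $\alpha^{\rightarrow}\in S(P)$. *)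

(* Defs.v *)
From mathcomp Require Import all_boot all_fingroup.

Set Implicit Arguments.
Unset Strict Implicit.
Unset Printing Implicit Defensive.

(* Positions and entries are 0-based: a permutation of {1, ..., n} in one-line
   notation is p : 'S_n, where p i + 1 is the entry in position i + 1. *)

(* A set of permutations of possibly different lengths, finite or infinite. *)
Definition perm_family := forall n : nat, 'S_n -> Prop.

Definition contains n k (p : 'S_n) (s : 'S_k) : Prop :=
  exists f : 'I_k -> 'I_n,
    (forall i j : 'I_k, i < j -> f i < f j) /\
    (forall i j : 'I_k, (s i < s j) = (p (f i) < p (f j))).

Definition avoids n k (p : 'S_n) (s : 'S_k) : Prop := ~ contains p s.

(* The class S(P), as the predicate of membership of a permutation of any
   length. *)
Definition avoidance_class (P : perm_family) : perm_family :=
  fun n p => forall k (s : 'S_k), P k s -> avoids p s.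

Definition max_pos m (a : 'S_m.+1) : 'I_m.+1 := (a^-1)%g ord_max.

(* Moving an entry by one position exchanges it with its neighbour.  In
   MathComp, (s * t)%g i = t (s i), so multiplying a by tperm i j on the left
   exchanges the entries in positions i and j of the one-line notation.
   None means that the moved permutation is undefined, in particular for the
   empty permutation. *)
Definition move_max_right n : 'S_n -> option 'S_n :=
  match n with
  | 0 => fun _ => None
  | m.+1 => fun a =>
      if max_pos a < m
      then Some (tperm (max_pos a) (inord (max_pos a).+1) * a)%g
      else None
  end.

Definition move_max_left n : 'S_n -> option 'S_n :=
  match n with
  | 0 => fun _ => None
  | m.+1 => fun a =>
      if 0 < max_pos a
      then Some (tperm (max_pos a) (inord (max_pos a).-1) * a)%g
      else None
  end.

Definition right_justified (P : perm_family) : Prop :=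
  forall n (a b : 'S_n),
    avoidance_class P a -> move_max_right a = Some b -> avoidance_class P b.

(* Main.v *)
(** Moving the maximum right and moving it left are mutually inverse.  If P is
    right-justified and u, obtained from t in P by moving the maximum left,
    avoided P, then so would t, which contains itself.  Conversely, let b be
    obtained from a by moving the maximum from position p to position p + 1,
    and let s in P occur in b.  If the occurrence misses p or p + 1, exchanging
    these positions gives an occurrence of s in a.  If it uses both, then the
    maximum of s is matched with position p + 1 and its left neighbour with
    position p, so the same positions of a carry s with its maximum moved left,
    which contains a pattern of P. *)
Require Import Defs.
From mathcomp Require Import all_boot all_fingroup.
From Stdlib Require Import Classical.
From mathcomp Require Import zify.

Set Implicit Arguments.
Unset Strict Implicit.
Unset Printing Implicit Defensive.

Lemma contains_refl n (s : 'S_n) : contains s s.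
Proof. by exists id. Qed.

Lemma contains_trans n k l (p : 'S_n) (s : 'S_k) (r : 'S_l) :
  contains p s -> contains s r -> contains p r.
Proof.
move=> [f [f_mono fE]] [g [g_mono gE]]; exists (f \o g); split=> i j /=.
  by move=> /g_mono/f_mono.
by rewrite gE fE.
Qed.

Lemma max_pos_max m (a : 'S_m.+1) x : a x <= a (max_pos a).
Proof. by rewrite /max_pos permKV -ltnS. Qed.

Lemma max_posE m (a : 'S_m.+1) p : (forall x, a x <= a p) -> max_pos a = p.
Proof.
move=> a_le; apply: (@perm_inj _ a); apply: val_inj; apply/eqP.
by rewrite eqn_leq a_le max_pos_max.
Qed.

(** Trades [max_pos] and [inord] for adjacent positions [p], [q], uniformly in [n]; both moves
    become the same exchange, with the maximum at [p] before a right move. *)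
Lemma move_max_rightP n (a b : 'S_n) :
  move_max_right a = Some b <->
  exists p q : 'I_n,
    [/\ q = p.+1 :> nat, forall x, a x <= a p & b = (tperm p q * a)%g].
Proof.
case: n a b => [|m] a b /=; first by split=> // -[[]].
split=> [|[p [q [qE a_le ->]]]].
  case: ifP => // lt_m [<-]; exists (max_pos a), (inord (max_pos a).+1).
  by split=> // [|x]; [rewrite inordK | exact: max_pos_max].
by rewrite (max_posE a_le) -qE inord_val ifT //; have := ltn_ord q; lia.
Qed.

Lemma move_max_leftP n (t u : 'S_n) :
  move_max_left t = Some u <->
  exists p q : 'I_n,
    [/\ q = p.+1 :> nat, forall x, t x <= t q & u = (tperm p q * t)%g].
Proof.
case: n t u => [|m] t u /=; first by split=> // -[[]].
split=> [|[p [q [qE t_le ->]]]].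
  case: ifP => // gt0 [<-]; exists (inord (max_pos t).-1), (max_pos t).
  split=> [|x|]; [|exact: max_pos_max|by rewrite tpermC].
  by rewrite inordK prednK // ltnW.
by rewrite (max_posE t_le) qE /= inord_val tpermC.
Qed.

Lemma move_max_leftK n (t u : 'S_n) :
  move_max_left t = Some u -> move_max_right u = Some t.
Proof.
move=> /move_max_leftP[p [q [qE t_le ->]]]; apply/move_max_rightP.
exists p, q; split=> // [x|]; first by rewrite !permM tpermL.
by rewrite mulgA tperm2 mul1g.
Qed.

(** Exchanging neighbours shifts each position by at most one, so only the exchanged pair can change
    order. *)
Lemma ltn_tperm_adjacent n (p q x y : 'I_n) :
  q = p.+1 :> nat -> x < y -> ~ (x = p /\ y = q) ->
  tperm p q x < tperm p q y.
Proof.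
move=> qE lt_xy nxy.
have {}nxy : ~ (x = p :> nat /\ y = q :> nat).
  by move=> [/val_inj xp /val_inj yq]; apply: nxy.
move: lt_xy nxy; case: tpermP => [->|->|/eqP + /eqP +];
  by case: tpermP => [->|->|/eqP + /eqP +]; rewrite -?val_eqE /=; lia.
Qed.

Lemma contains_move_max_right n k (a b : 'S_n) (s : 'S_k) :
  move_max_right a = Some b -> contains b s ->
  contains a s \/ exists2 u, move_max_left s = Some u & contains a u.
Proof.
move=> /move_max_rightP[p [q [qE a_le ->]]] [f [f_mono fE]].
have [[i [j [fi fj]]]|nij] := classic (exists i j, f i = p /\ f j = q).
  right; exists (tperm i j * s)%g.
    have f_ltE x y : (f x < f y) = (x < y).
      case: (ltngtP x y) => [/f_mono //|/f_mono|/val_inj->]; last exact: ltnn.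
      by move=> lt_yx; apply/negbTE; rewrite -leqNgt ltnW.
    apply/move_max_leftP; exists i, j; split=> // [|x].
      (* No position of [s] lies between [i] and [j], as none lies between
         [p] and [q]. *)
      have lt_ij : i < j by rewrite -f_ltE fi fj qE.
      apply/eqP; rewrite eqn_leq lt_ij andbT leqNgt; apply/negP => lt_i1j.
      pose h := Ordinal (ltn_trans lt_i1j (ltn_ord j)).
      have := f_mono i h (leqnn _); have := f_mono h j lt_i1j.
      by rewrite fi fj qE; lia.
    (* After the right move, position [q = f j] holds [a p], the maximum, so [s j] is maximal in
       [s]. *)
    by rewrite leqNgt fE !permM fj tpermR -leqNgt.
  have f_inj : injective f.
    move=> x y fxy; apply: val_inj; case: (ltngtP x y) => // /f_mono.
      by rewrite fxy ltnn.
    by rewrite fxy ltnn.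
  exists f; split=> // x y.
  (* Since [f] is injective, it carries the exchange of [i], [j] to that of [p], [q], which then
     cancels the right move. *)
  have swap z : f (tperm i j z) = tperm p q (f z) by rewrite -fi -fj inj_tperm.
  by rewrite !permM fE !swap !permM !tpermK.
left; exists (fun x => tperm p q (f x)); split=> x y.
  move=> /f_mono lt_f; apply: ltn_tperm_adjacent => // fxy.
  by apply: nij; exists x, y.
by rewrite fE !permM.
Qed.

Theorem theorem1 (P : perm_family) :
  right_justified P <->
  (forall (n : nat) (t u : 'S_n),
     P n t -> move_max_left t = Some u ->
     exists (k : nat) (s : 'S_k), P k s /\ contains u s).
Proof.
split=> [rjP n t u Pt tu | leftP n a b avoids_a ab k s Ps b_s].
  apply: NNPP => no_s.
  have avoids_u : avoidance_class P u.
    by move=> k s Ps u_s; apply: no_s; exists k, s.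
  exact: rjP avoids_u (move_max_leftK tu) _ _ Pt (contains_refl t).
have [a_s|[u su a_u]] := contains_move_max_right ab b_s.
  exact: avoids_a Ps a_s.
have [l [r [Pr u_r]]] := leftP _ _ _ Ps su.
exact: avoids_a Pr (contains_trans a_u u_r).
Qed.
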